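(* Let $\mathcal{A}$, $\mathcal{B}$ be ordered groups and $\mathcal{M}=\mathcal{A}\times\mathcal{B}$. Let $x_{12},x_{13},x_{14},x_{23},x_{24},x_{34}$ be independent symbols, let $\mathfrak{G}$ be the free abelian group on these six symbols, let $F$ be the field of fractions of the group algebra $\mathbb{Q}\mathfrak{G}$, and let $L=F\mathcal{M}$ be the group algebra of $\mathcal{M}$ over $F$. Let $$X=\begin{pmatrix}1&x_{12}&x_{13}&x_{14}\\0&1&x_{23}&x_{24}\\0&0&1&x_{34}\\0&0&0&1\end{pmatrix}$$ viewed as a matrix over $L$ (each $x_{ij}$ identified with $x_{ij}\cdot e$, $e$ the identity of $\mathcal{M}$). Let $a\in L$ with $a\neq 0$ and $a\neq 1$, and let $A=\mathrm{diag}(1,a,1,a)$, where $1$ is the unit of $L$. Then every entry $b_{ik}$ with $i\le k$ of the matrix $B=X^{-1}AX$ is non-zero.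
   Context: An ordered group is a group with a total order $>$ (exactly one of $x>y$, $y>x$, $x=y$; transitive) satisfying $x>y \Rightarrow axb>ayb$ for all $a,b$. The group algebra $K H$ of a group $H$ over a field $K$ consists of formal finite $K$-linear combinations of elements of $H$ with the usual operations. *)

(* Defs.v *)
From HB Require Import structures.
From mathcomp Require Import all_boot all_order all_algebra.
From mathcomp Require Import finmap.
From mathcomp.multinomials Require Import xfinmap monalg.

Set Implicit Arguments.
Unset Strict Implicit.
Unset Printing Implicit Defensive.

Import GRing.Theory.
Local Open Scope fset.
Local Open Scope fmap.
Local Open Scope ring_scope.

HB.mixin Record Choice_isGrp V of Choice V := {
  gone : V;
  gmul : V -> V -> V;
  ginv : V -> V;
  gmulA : associative gmul;
  gmul1g : left_id gone gmul;
  gmulg1 : right_id gone gmul;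
  gmulVg : left_inverse gone ginv gmul;
  gmulgV : right_inverse gone ginv gmul
}.

#[short(type="grpType")]
HB.structure Definition Grp := { V of Choice V & Choice_isGrp V }.

Section ProdGrp.
Variables (A B : grpType).
Definition pgmul (x y : A * B) : A * B := (gmul x.1 y.1, gmul x.2 y.2).
Definition pgone : A * B := (gone, gone).
Definition pginv (x : A * B) : A * B := (ginv x.1, ginv x.2).
Lemma pgmulA : associative pgmul.
Proof. by move=> x y z; rewrite /pgmul /= !gmulA. Qed.
Lemma pgmul1g : left_id pgone pgmul.
Proof. by case=> x y; rewrite /pgmul /= !gmul1g. Qed.
Lemma pgmulg1 : right_id pgone pgmul.
Proof. by case=> x y; rewrite /pgmul /= !gmulg1. Qed.
Lemma pgmulVg : left_inverse pgone pginv pgmul.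
Proof. by case=> x y; rewrite /pgmul /= !gmulVg. Qed.
Lemma pgmulgV : right_inverse pgone pginv pgmul.
Proof. by case=> x y; rewrite /pgmul /= !gmulgV. Qed.
HB.instance Definition _ := Choice_isGrp.Build (A * B)%type
  pgmulA pgmul1g pgmulg1 pgmulVg pgmulgV.
End ProdGrp.

Definition ordered_group (G : grpType) (gt : G -> G -> Prop) : Prop :=
  [/\ (forall x y : G, gt x y \/ gt y x \/ x = y),
      (forall x y : G, gt x y -> ~ gt y x),
      (forall x : G, ~ gt x x),
      (forall x y z : G, gt x y -> gt y z -> gt x z) &
      (forall a b x y : G, gt x y -> gt (gmul (gmul a x) b) (gmul (gmul a y) b))].

Definition galg (K : grpType) (R : ringType) := {malg R[K]}.

HB.instance Definition _ (K : grpType) (R : ringType) :=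
  GRing.Lmodule.on (galg K R).

Section GAlgRing.
Context (K : grpType) (R : ringType).
Implicit Types (g : galg K R) (k l : K).

Definition gfone : galg K R := << gone >>.

Local Notation "g1 *M_[ k1 , k2 ] g2" :=
  (<< (mcoeff k1 g1) * (mcoeff k2 g2) *g (gmul k1 k2) >> : galg K R)
  (at level 40, no associativity).

Definition gfmul g1 g2 : galg K R :=
  \sum_(k1 <- msupp g1) \sum_(k2 <- msupp g2) g1 *M_[k1, k2] g2.

Lemma gfmull g1 g2 :
  gfmul g1 g2 = \sum_(k1 <- msupp g1) \sum_(k2 <- msupp g2) g1 *M_[k1, k2] g2.
Proof. by []. Qed.

Lemma gfmulr g1 g2 :
  gfmul g1 g2 = \sum_(k2 <- msupp g2) \sum_(k1 <- msupp g1) g1 *M_[k1, k2] g2.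
Proof. by rewrite gfmull exchange_big. Qed.

Lemma gfmullw (d1 d2 : {fset K}) g1 g2 :
  msupp g1 `<=` d1 -> msupp g2 `<=` d2 ->
  gfmul g1 g2 = \sum_(k1 <- d1) \sum_(k2 <- d2) g1 *M_[k1, k2] g2.
Proof.
move=> le_d1 le_d2; rewrite gfmull (big_fset_incl _ le_d1) /=.
  apply/eq_bigr=> k1 _; apply/big_fset_incl => // k _ /mcoeff_outdom ->.
  by rewrite mulr0 monalgU0.
move=> k _ /mcoeff_outdom g1k.
by rewrite big1 => // k' _; rewrite g1k mul0r monalgU0.
Qed.

Lemma gfmulrw (d1 d2 : {fset K}) g1 g2 : msupp g1 `<=` d1 -> msupp g2 `<=` d2
  -> gfmul g1 g2 = \sum_(k2 <- d2) \sum_(k1 <- d1) g1 *M_[k1, k2] g2.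
Proof. by move=> le_d1 le_d2; rewrite (gfmullw le_d1 le_d2) exchange_big. Qed.

Definition gfmullwl (d1 : {fset K}) {g1 g2} (le : msupp g1 `<=` d1) :=
  @gfmullw _ _ g1 g2 le (fsubset_refl _).

Definition gfmulrwl (d2 : {fset K}) {g1 g2} (le : msupp g2 `<=` d2) :=
  @gfmulrw _ _ g1 g2 (fsubset_refl _) le.

Lemma gfmul0g : left_zero 0 gfmul.
Proof. by move=> g; rewrite gfmull msupp0 big_seq_fset0. Qed.

Lemma gfmulg0 : right_zero 0 gfmul.
Proof. by move=> g; rewrite gfmulr msupp0 big_seq_fset0. Qed.

Lemma gfmulUg c k g :
  gfmul << c *g k >> g = \sum_(k' <- msupp g) << c * (mcoeff k' g) *g gmul k k' >>.
Proof.
rewrite (gfmullw msuppU_le (fsubset_refl _)) big_seq_fset1.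
by apply/eq_bigr => k' _; rewrite mcoeffUU.
Qed.

Lemma gfmulgU c k g :
  gfmul g << c *g k >> = \sum_(k' <- msupp g) << (mcoeff k' g) * c *g gmul k' k >>.
Proof.
rewrite (gfmulrw (fsubset_refl _) msuppU_le) big_seq_fset1.
by apply/eq_bigr=> k' _; rewrite mcoeffUU.
Qed.

Lemma gfmulUU c1 c2 k1 k2 :
  gfmul << c1 *g k1 >> << c2 *g k2 >> = << c1 * c2 *g gmul k1 k2 >> :> galg K R.
Proof. by rewrite (gfmulrw msuppU_le msuppU_le) !big_seq_fset1 !mcoeffUU. Qed.

Lemma gfmulEl1 g1 g2 :
  gfmul g1 g2 = \sum_(k1 <- msupp g1) gfmul << (mcoeff k1 g1) *g k1 >> g2.
Proof. by apply/eq_bigr=> k _; rewrite gfmulUg. Qed.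

Lemma gfmulEr1 g1 g2 :
  gfmul g1 g2 = \sum_(k2 <- msupp g2) gfmul g1 << (mcoeff k2 g2) *g k2 >>.
Proof. by rewrite gfmulr; apply/eq_bigr=> k _; rewrite gfmulgU. Qed.

Lemma gfmul1g : left_id gfone gfmul.
Proof.
move=> g; rewrite gfmulUg [RHS]monalgE.
by apply/eq_bigr=> kg _; rewrite mul1r gmul1g.
Qed.

Lemma gfmulg1 : right_id gfone gfmul.
Proof.
move=> g; rewrite gfmulgU [RHS]monalgE.
by apply/eq_bigr=> k _; rewrite mulr1 gmulg1.
Qed.

Lemma gfmulgDl : left_distributive gfmul +%R.
Proof.
move=> g1 g2 g; rewrite [in RHS](gfmullwl (fsubsetUl _ (msupp g2))).
rewrite [in RHS](gfmullwl (fsubsetUr (msupp g1) _)) (gfmullwl (msuppD_le _ _)).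
rewrite -big_split /=; apply/eq_bigr=> k1 _.
rewrite -big_split /=; apply/eq_bigr=> k2 _.
by rewrite mcoeffD mulrDl monalgUD.
Qed.

Lemma gfmulgDr : right_distributive gfmul +%R.
Proof.
move=> g g1 g2; rewrite [in RHS](gfmulrwl (fsubsetUl _ (msupp g2))).
rewrite [in RHS](gfmulrwl (fsubsetUr (msupp g1) _)) (gfmulrwl (msuppD_le _ _)).
rewrite -big_split /=; apply/eq_bigr => k1 _.
rewrite -big_split /=; apply/eq_bigr => k2 _.
by rewrite mcoeffD mulrDr monalgUD.
Qed.

Lemma gfmulA : associative gfmul.
Proof.
move=> g1 g2 g3.
rewrite [RHS](big_morph (gfmul^~ _) (fun _ _ => gfmulgDl _ _ _) (gfmul0g _)).
rewrite gfmulEl1; apply/eq_bigr=> k1 _.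
rewrite [LHS](big_morph (gfmul _) (fun _ _ => gfmulgDr _ _ _) (gfmulg0 _)).
rewrite [RHS](big_morph (gfmul^~ _) (fun _ _ => gfmulgDl _ _ _) (gfmul0g _)).
apply/eq_bigr=> k2 _.
rewrite [LHS](big_morph (gfmul _) (fun _ _ => gfmulgDr _ _ _) (gfmulg0 _)).
by rewrite gfmulEr1; apply/eq_bigr=> k3 _; rewrite !gfmulUU mulrA gmulA.
Qed.

Lemma gfoner_eq0 : gfone != 0.
Proof. by apply/eqP/malgP=> /(_ gone) /eqP; rewrite mcoeffUU mcoeff0 oner_eq0. Qed.

HB.instance Definition _ := GRing.Zmodule_isRing.Build (galg K R)
  gfmulA gfmul1g gfmulg1 gfmulgDl gfmulgDr gfoner_eq0.
End GAlgRing.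

From mathcomp.multinomials Require Import mpoly.
From mathcomp Require Import fraction.

(* F = field of fractions of  Q[G], G free abelian on x12,...,x34,    *)
(* realised as Q(x12,x13,x14,x23,x24,x34) = Frac Q[x12,...,x34]      *)
(* (Q[G] is the localisation of Q[x_ij] at monomials, same fraction    *)
Definition F : fieldType := {fraction (mpoly.mpoly 6 rat)}.

Definition sym_index (i j : 'I_4) : 'I_6 :=
  inord (match nat_of_ord i, nat_of_ord j with
         | 0, 1 => 0 | 0, 2 => 1 | 0, 3 => 2
         | 1, 2 => 3 | 1, 3 => 4 | 2, 3 => 5
         | _, _ => 0 end)%N.

Definition xsym (i j : 'I_4) : F := tofrac ('X_(sym_index i j) : mpoly.mpoly 6 rat).

Definition L (A B : grpType) : ringType := galg (A * B)%type F.

Definition scal (A B : grpType) (c : F) : L A B := c *: (1 : L A B).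

Definition Xmat (A B : grpType) : 'M[L A B]_4 :=
  \matrix_(i < 4, j < 4)
    (if i == j then 1 else if (i < j)%N then scal A B (xsym i j) else 0).

Definition Amat (A B : grpType) (a : L A B) : 'M[L A B]_4 :=
  \matrix_(i < 4, j < 4) (if i == j then (if odd i then a else 1) else 0).

(* Main.v *)
(* Over F the matrix X is unitriangular, and for D = diag(0,1,0,1) an explicit
   matrix C, polynomial in the x_ij, satisfies X C = D X.  Since
   A = 1 + D (a - 1) and the scalars of F are central in L, this gives
   X^-1 A X = 1 + C (a - 1).  The diagonal of C is that of D, so the diagonal
   entries of B are 1 or a; above the diagonal the entries of C are non-zero
   rational functions of the x_ij, so b_ik = c_ik (a - 1) is a non-zero scalar
   times a non-zero vector of the F-vector space L. *)

Require Import Defs.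
From HB Require Import structures.
From mathcomp Require Import all_boot all_order all_algebra.
From mathcomp.multinomials Require Import monalg mpoly.
From mathcomp Require Import ring.

Set Implicit Arguments.
Unset Strict Implicit.
Unset Printing Implicit Defensive.

Import GRing.Theory.
Local Open Scope ring_scope.

Section GalgAlgebra.
Variables (K : grpType) (R : comNzRingType).
Implicit Types (c : R) (g : galg K R).

Lemma galg_scaleU c x (k : K) : c *: << x *g k >> = << c * x *g k >> :> galg K R.
Proof.
apply/monalg.malgP=> k'; rewrite monalg.mcoeffZ !monalg.mcoeffU.
by case: eqP; rewrite ?mulr0.
Qed.

Lemma galg_alg1E c : c *: (1 : galg K R) = << c *g gone >>.
Proof. by rewrite galg_scaleU mulr1. Qed.

Lemma galg_mulr_algl c g : (c *: (1 : galg K R)) * g = c *: g.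
Proof.
rewrite galg_alg1E; change (gfmul << c *g gone >> g = c *: g).
rewrite gfmulUg [in RHS](monalgE g) scaler_sumr.
by apply/eq_bigr=> k _; rewrite galg_scaleU gmul1g.
Qed.

Lemma galg_mulr_algr c g : g * (c *: (1 : galg K R)) = c *: g.
Proof.
rewrite galg_alg1E; change (gfmul g << c *g gone >> = c *: g).
rewrite gfmulgU [in RHS](monalgE g) scaler_sumr.
by apply/eq_bigr=> k _; rewrite galg_scaleU gmulg1 mulrC.
Qed.

Lemma galg_scalerAl c g1 g2 : c *: (g1 * g2) = (c *: g1) * g2.
Proof. by rewrite -galg_mulr_algl mulrA galg_mulr_algl. Qed.

Lemma galg_scalerAr c g1 g2 : c *: (g1 * g2) = g1 * (c *: g2).
Proof. by rewrite -[in RHS]galg_mulr_algr mulrA galg_mulr_algr. Qed.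

HB.instance Definition _ :=
  GRing.Lmodule_isLalgebra.Build R (galg K R) galg_scalerAl.
HB.instance Definition _ :=
  GRing.Lalgebra_isAlgebra.Build R (galg K R) galg_scalerAr.

End GalgAlgebra.

Section ScalarMatrices.
Variables (R : comNzRingType) (L : algType R).

Lemma mul_alg_scale_mx m n p (P : 'M[R]_(m, n)) (Q : 'M[R]_(n, p)) (b : L) :
  map_mx (in_alg L) P *m map_mx ( *:%R^~ b) Q = map_mx ( *:%R^~ b) (P *m Q).
Proof.
apply/matrixP=> i k; rewrite !mxE scaler_suml; apply: eq_bigr => j _.
by rewrite !mxE /= mulr_algl scalerA.
Qed.

Lemma mul_scale_alg_mx m n p (P : 'M[R]_(m, n)) (Q : 'M[R]_(n, p)) (b : L) :
  map_mx ( *:%R^~ b) P *m map_mx (in_alg L) Q = map_mx ( *:%R^~ b) (P *m Q).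
Proof.
apply/matrixP=> i k; rewrite !mxE scaler_suml; apply: eq_bigr => j _.
by rewrite !mxE /= mulr_algr scalerA mulrC.
Qed.

Lemma conj_scale_mx n (U C D : 'M[R]_n) (b : L) : U *m C = D *m U ->
  map_mx (in_alg L) U *m (1%:M + map_mx ( *:%R^~ b) C) =
  (1%:M + map_mx ( *:%R^~ b) D) *m map_mx (in_alg L) U.
Proof.
move=> UC_DU; rewrite mulmxDr mulmxDl mulmx1 mul1mx.
by rewrite mul_alg_scale_mx mul_scale_alg_mx UC_DU.
Qed.

End ScalarMatrices.

Definition odd_diag {R : pzSemiRingType} n : 'M[R]_n :=
  diag_mx (\row_(j < n) (odd j)%:R).

(* Indices are 0-based: [x i j] plays the role of x_{i+1,j+1}. *)
Section UnitriangularConjugation.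
Variables (R : comNzRingType) (x : nat -> nat -> R).

Definition unitri_mx : 'M[R]_4 :=
  \matrix_(i, j) if i == j then 1 else if (i < j)%N then x i j else 0.

Definition conj_coef_mx : 'M[R]_4 :=
  \matrix_(i, j) match nat_of_ord i, nat_of_ord j with
  | 0, 1 => - x 0 1
  | 0, 2 => - (x 0 1 * x 1 2)
  | 0, 3 => x 0 2 * x 2 3 - x 0 3 - x 0 1 * x 1 2 * x 2 3
  | 1, 2 => x 1 2
  | 1, 3 => x 1 2 * x 2 3
  | 2, 3 => - x 2 3
  | 1, 1 | 3, 3 => 1
  | _, _ => 0
  end.

Lemma unitri_conj_coef : unitri_mx *m conj_coef_mx = odd_diag 4 *m unitri_mx.
Proof.
apply/matrixP=> -[[|[|[|[|//]]]] ?] [[|[|[|[|//]]]] ?];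
  by rewrite !mxE !big_ord_recr !big_ord0 /= !mxE /=; ring.
Qed.

Lemma conj_coef_diag i : conj_coef_mx i i = (odd i)%:R.
Proof. by case: i => -[|[|[|[|//]]]] ?; rewrite mxE. Qed.

End UnitriangularConjugation.

Definition xsym_nat (i j : nat) : F := xsym (inord i) (inord j).

Lemma tofrac_neq0 (v : 'I_6 -> rat) (p : mpoly 6 rat) :
  meval v p != 0 -> tofrac p != 0.
Proof. by rewrite tofrac_eq0; apply: contraNneq => ->; rewrite meval0. Qed.

Lemma xsym_nat_neq0 i j : xsym_nat i j != 0.
Proof. by apply: (@tofrac_neq0 (fun _ => 1)); rewrite mevalXU oner_eq0. Qed.

Lemma conj_coef_corner_neq0 :
  xsym_nat 0 2 * xsym_nat 2 3 - xsym_nat 0 3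
    - xsym_nat 0 1 * xsym_nat 1 2 * xsym_nat 2 3 != 0.
Proof.
rewrite /xsym_nat /xsym -!tofracM -!tofracB.
apply: (@tofrac_neq0 (fun k => (val k == 2)%:R)).
by rewrite !mevalB !mevalM !mevalXU /sym_index !inordK //= !inordK.
Qed.

Lemma conj_coef_upper_neq0 (i k : 'I_4) :
  (i < k)%N -> conj_coef_mx xsym_nat i k != 0.
Proof.
case: i k => -[|[|[|[|//]]]] ? [[|[|[|[|//]]]] ?] //= _; rewrite mxE /=;
  by rewrite ?oppr_eq0 ?mulf_neq0 ?xsym_nat_neq0 ?conj_coef_corner_neq0.
Qed.

Section GroupAlgebraMatrices.
Variables (A B : grpType).

Lemma Xmat_alg : Xmat A B = map_mx (in_alg (L A B)) (unitri_mx xsym_nat).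
Proof.
apply/matrixP=> i j; rewrite !mxE /xsym_nat !inord_val.
by case: eqP => _; [rewrite rmorph1 | case: ifP => _; rewrite ?rmorph0].
Qed.

Lemma Amat_odd_diag (a : L A B) :
  Amat a = 1%:M + map_mx ( *:%R^~ (a - 1)) (odd_diag 4).
Proof.
apply/matrixP=> i j; rewrite !mxE; case: eqP => [->|_]; last first.
  by rewrite mulr0n scale0r addr0.
by case: (odd j); rewrite ?scale1r ?scale0r (addr0, addrC 1 (a - 1)) ?subrK.
Qed.

Lemma Xmat_conj_Amat (a : L A B) :
  Xmat A B *m (1%:M + map_mx ( *:%R^~ (a - 1)) (conj_coef_mx xsym_nat)) =
  Amat a *m Xmat A B.
Proof.
rewrite Amat_odd_diag Xmat_alg; exact/conj_scale_mx/unitri_conj_coef.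
Qed.

End GroupAlgebraMatrices.

Theorem lemma4 (A B : grpType)
    (gtA : A -> A -> Prop) (gtB : B -> B -> Prop)
    (hA : ordered_group gtA) (hB : ordered_group gtB)
    (a : L A B) (ha0 : a != 0) (ha1 : a != 1)
    (Xinv : 'M[L A B]_4)
    (hXl : Xinv *m Xmat A B = 1%:M) (hXr : Xmat A B *m Xinv = 1%:M) :
  forall i k : 'I_4, (i <= k)%N ->
    (Xinv *m Amat a *m Xmat A B) i k != 0.
Proof.
move=> i k le_ik.
rewrite -mulmxA -Xmat_conj_Amat mulmxA hXl mul1mx 3!mxE.
case: ltngtP le_ik => // [lt_ik _ | /val_inj <- _].
  have /negPf -> : i != k by rewrite neq_ltn lt_ik.
  rewrite mulr0n add0r scaler_eq0 negb_or conj_coef_upper_neq0 // andTb subr_eq0.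
  exact: ha1.
rewrite eqxx conj_coef_diag; case: (odd i).
  rewrite !mulr1n scale1r addrC subrK; exact: ha0.
rewrite mulr1n mulr0n scale0r addr0; exact: oner_neq0.
Qed.
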